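(* Let $\mathbf{X}$ and $\mathbf{Y}$ be two $d$-parameter persistence modules and let $\mathbb{I}=I_1\times\cdots\times I_d\subset\mathbb{R}^d$, where each $I_i$ is a closed bounded interval of the real line. Then $$d_{match}(\mathbf{X}^{\mathbb{I}},\mathbf{Y}^{\mathbb{I}})\le d_{match}(\mathbf{X},\mathbf{Y}),$$ where $d_{match}(\mathbf{X}^{\mathbb{I}},\mathbf{Y}^{\mathbb{I}})$ is computed by restricting, for each line $L$, the diagrams $\mathrm{Dg}\,\mathbf{X}_L$ and $\mathrm{Dg}\,\mathbf{Y}_L$ to the subinterval of the line $L$ passing through the region $\mathbb{I}$.
   Context: $d$-parameter persistence module. A family of vector spaces $\{\mathbb{V}_u\}_{u\in\mathbb{R}^d}$ over a field together with linear maps $\varphi_{\mathbb{V}}(u,v):\mathbb{V}_u\to\mathbb{V}_v$ for $u\preceq v$ (meaning $u_i\le v_i$ for all $i$) such that $\varphi_{\mathbb{V}}(u,u)=\mathrm{id}_{\mathbb{V}_u}$ and $\varphi_{\mathbb{V}}(v,w)\circ\varphi_{\mathbb{V}}(u,v)=\varphi_{\mathbb{V}}(u,w)$ for $u\preceq v\preceq w$. Restriction to lines. Let $L\subset\mathbb{R}^d$ be a line with direction $\mathbf{m}=(m_1,\dots,m_d)$, $\min_i m_i>0$, parametrized as $s\mapsto s\,\mathbf{m}+c$, $s\in\mathbb{R}$. Restricting $\mathbf{X}$ along $L$ gives a one-parameter persistence module $\mathbf{X}_L$ indexed by $s\in\mathbb{R}$. The modules are assumed to be such that these one-parameter modules decompose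 into interval modules (e.g. pointwise finite-dimensional modules). $\mathrm{Dg}\,\mathbf{X}_L$ is the multiset of pairs $(b,d)$ of endpoints (possibly infinite) of these intervals, together with countably many copies of every diagonal point $(x,x)$, $x\in\mathbb{R}$. Bottleneck distance. $d_B(D,D')=\inf_\mu\sup_x\|x-\mu(x)\|_\infty\in[0,\infty]$, over all bijections $\mu:D\to D'$ of multisets (equal infinite coordinates are at difference $0$). Matching distance. $d_{match}(\mathbf{X},\mathbf{Y})=\sup_L\ \big(\min_i m_i\big)\, d_B(\mathrm{Dg}\,\mathbf{X}_L,\mathrm{Dg}\,\mathbf{Y}_L)$, the supremum over all lines $L$ with direction $\mathbf{m}$ satisfying $\min_i m_i>0$. (The quantity $(\min_i m_i)\,d_B$ does not depend on the choice of direction vector and base point parametrizing $L$.) Restriction of a diagram. For an interval $I=[r_1,r_2]\subset\mathbb{R}$, the restriction $D^I$ of a diagram $D$ is its multiset image (multiplicities retained) under the map $\Pi$ given by (A) $\Pi(b,d)=(b,d)$ if $r_1\le b\le d\le r_2$; (B) $\Pi(b,d)=(b,r_2)$ if $r_1\le b\le r_2\le d$; (C) $\Pi(b,d)=(r_1,d)$ if $b\le r_1\le d\le r_2$; (D) $\Pi(b,d)=(r_1,r_2)$ if $b\le r_1\le r_2\le d$; (E) $\Pi(b,d)=(b,b)$ if $r_2\le b$; (F) $\Pi(b,d)=(d,d)$ if $d\le r_1$. Restricted matching distance. For a line $L$ meeting $\mathbb{I}$, let $I_L$ be the interval of parameters $s$ for which $s\mathbf{m}+c\in\mathbb{I}$.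 Then $d_{match}(\mathbf{X}^{\mathbb{I}},\mathbf{Y}^{\mathbb{I}})=\sup_L(\min_i m_i)\,d_B\big((\mathrm{Dg}\,\mathbf{X}_L)^{I_L},(\mathrm{Dg}\,\mathbf{Y}_L)^{I_L}\big)$, where lines not meeting $\mathbb{I}$ contribute $0$ (with the convention that the supremum is $0$ if no line meets $\mathbb{I}$). *)

(* Defs.v *)
From HB Require Import structures.
From mathcomp Require Import all_boot all_order all_algebra.
From mathcomp Require Import all_classical all_reals all_analysis.

Set Implicit Arguments.
Unset Strict Implicit.
Unset Printing Implicit Defensive.

Import Order.TTheory GRing.Theory Num.Theory.

Local Open Scope classical_set_scope.
Local Open Scope ring_scope.

Record persmod (K : fieldType) (T : Type) (le : T -> T -> Prop) := Persmod {
  pm_space :> T -> lmodType K;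
  pm_map : forall u v, le u v -> {linear pm_space u -> pm_space v};
  pm_map_id : forall u (huu : le u u), pm_map huu =1 id;
  pm_map_comp : forall u v w (huv : le u v) (hvw : le v w) (huw : le u w),
    pm_map hvw \o pm_map huv =1 pm_map huw }.

Record persmod_iso (K : fieldType) (T : Type) (le : T -> T -> Prop)
    (M N : persmod K le) := PersmodIso {
  iso_map : forall t, {linear M t -> N t};
  iso_map_bij : forall t, bijective (iso_map t);
  iso_map_natural : forall s t (hst : le s t),
    iso_map t \o pm_map M hst =1 pm_map N hst \o iso_map s }.

Definition pm_pullback (K : fieldType) (S T : Type) (leS : S -> S -> Prop)
    (leT : T -> T -> Prop) (f : S -> T)
    (fmono : forall s t, leS s t -> leT (f s) (f t)) (M : persmod K leT) :
  persmod K leS :=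
  @Persmod K S leS (fun s => M (f s))
    (fun s t hst => pm_map M (fmono s t hst))
    (fun s hss => pm_map_id (fmono s s hss))
    (fun s t u hst htu hsu =>
       pm_map_comp (fmono s t hst) (fmono t u htu) (fmono s u hsu)).

Definition leR (R : realType) (s t : R) : Prop := s <= t.

Definition preceq (R : realType) (n : nat) (u v : 'rV[R]_n) : Prop :=
  forall i, u 0 i <= v 0 i.

(* One-parameter and multiparameter modules; a d-parameter module with d >= 1
   is a [mpm K R d'] with d = d'.+1 (a direction vector needs a least
   coordinate). *)
Notation opm K R := (persmod K (@leR R)).
Notation mpm K R d := (persmod K (@preceq R d.+1)).

Section DirectSum.
Variables (K : fieldType) (J : Type) (V : J -> lmodType K).

Record dsum := Dsum {
  dsum_val :> forall j, V j;
  dsum_finite : finite_set [set j | dsum_val j <> 0] }.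

Lemma dsum_ext (f g : dsum) : (forall j, f j = g j) -> f = g.
Proof.
case: f g => [f hf] [g hg] /= fg.
have {}fg : f = g by apply: functional_extensionality_dep.
by subst g; congr Dsum; exact: Prop_irrelevance.
Qed.

Lemma dsum0_finite : finite_set [set j | (0 : V j) <> 0].
Proof. by apply: (@sub_finite_set _ _ set0) => // j /=. Qed.

Lemma dsumD_finite (f g : dsum) : finite_set [set j | f j + g j <> 0].
Proof.
apply: (@sub_finite_set _ _ ([set j | f j <> 0] `|` [set j | g j <> 0])).
  move=> j /= fgj; have [fj|fj] := pselect (f j = 0); last by left.
  by right => gj; apply: fgj; rewrite fj gj addr0.
by rewrite finite_setU; split; exact: dsum_finite.
Qed.

Lemma dsumN_finite (f : dsum) : finite_set [set j | - f j <> 0].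
Proof.
apply: (sub_finite_set _ (dsum_finite f)) => j /= fj fj0.
by apply: fj; rewrite fj0 oppr0.
Qed.

Lemma dsumZ_finite (k : K) (f : dsum) : finite_set [set j | k *: f j <> 0].
Proof.
apply: (sub_finite_set _ (dsum_finite f)) => j /= fj fj0.
by apply: fj; rewrite fj0 scaler0.
Qed.

Definition dsum_zero := Dsum dsum0_finite.
Definition dsum_add f g := Dsum (dsumD_finite f g).
Definition dsum_opp f := Dsum (dsumN_finite f).
Definition dsum_scale k f := Dsum (dsumZ_finite k f).

HB.instance Definition _ := gen_eqMixin dsum.
HB.instance Definition _ := gen_choiceMixin dsum.

Let dsum_addA : associative dsum_add.
Proof. by move=> f g h; apply: dsum_ext => j /=; rewrite addrA. Qed.
Let dsum_addC : commutative dsum_add.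
Proof. by move=> f g; apply: dsum_ext => j /=; rewrite addrC. Qed.
Let dsum_add0 : left_id dsum_zero dsum_add.
Proof. by move=> f; apply: dsum_ext => j /=; rewrite add0r. Qed.
Let dsum_addN : left_inverse dsum_zero dsum_opp dsum_add.
Proof. by move=> f; apply: dsum_ext => j /=; rewrite addNr. Qed.

HB.instance Definition _ :=
  GRing.isZmodule.Build dsum dsum_addA dsum_addC dsum_add0 dsum_addN.

Let dsum_scaleA a b (f : dsum) :
  dsum_scale a (dsum_scale b f) = dsum_scale (a * b) f.
Proof. by apply: dsum_ext => j /=; rewrite scalerA. Qed.
Let dsum_scale1 : left_id 1 dsum_scale.
Proof. by move=> f; apply: dsum_ext => j /=; rewrite scale1r. Qed.
Let dsum_scaleDr : right_distributive dsum_scale +%R.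
Proof. by move=> a f g; apply: dsum_ext => j /=; rewrite scalerDr. Qed.
Let dsum_scaleDl (f : dsum) : {morph dsum_scale^~ f : a b / a + b}.
Proof. by move=> a b; apply: dsum_ext => j /=; rewrite scalerDl. Qed.

HB.instance Definition _ := GRing.Zmodule_isLmodule.Build K dsum
  dsum_scaleA dsum_scale1 dsum_scaleDr dsum_scaleDl.

End DirectSum.

Section DirectSumMap.
Variables (K : fieldType) (J : Type) (V W : J -> lmodType K).
Variable F : forall j, {linear V j -> W j}.

Lemma dsum_map_finite (f : dsum V) : finite_set [set j | F j (f j) <> 0].
Proof.
apply: (sub_finite_set _ (dsum_finite f)) => j /= fj fj0.
by apply: fj; rewrite fj0 linear0.
Qed.

Definition dsum_map (f : dsum V) : dsum W := Dsum (dsum_map_finite f).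

Let dsum_map_linear : linear dsum_map.
Proof. by move=> a f g; apply: dsum_ext => j /=; rewrite linearP. Qed.

HB.instance Definition _ :=
  GRing.isLinear.Build K (dsum V) (dsum W) *:%R dsum_map dsum_map_linear.

End DirectSumMap.

Section DirectSumPersmod.
Variables (K : fieldType) (T : Type) (le : T -> T -> Prop).
Variables (J : Type) (N : J -> persmod K le).

Let space (t : T) : lmodType K := dsum (fun j => N j t).
Let map s t (hst : le s t) : {linear space s -> space t} :=
  dsum_map (fun j => pm_map (N j) hst).

Let map_id t (htt : le t t) : map htt =1 id.
Proof. by move=> f; apply: dsum_ext => j /=; rewrite pm_map_id. Qed.
Let map_comp s t u (hst : le s t) (htu : le t u) (hsu : le s u) :
  map htu \o map hst =1 map hsu.
Proof.
by move=> f; apply: dsum_ext => j /=; rewrite -(pm_map_comp hst htu hsu).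
Qed.

Definition pm_dsum : persmod K le := Persmod map_id map_comp.

End DirectSumPersmod.

Record intervalset (R : realType) := Intervalset {
  itv_carrier :> set R;
  itv_nonempty : itv_carrier !=set0;
  itv_convex : is_interval itv_carrier }.

Section IntervalModule.
Variables (K : fieldType) (R : realType) (I : intervalset R).

(* [K^1] on the interval and [K^0] off it, with the all-ones matrices as
   structure maps: the identity of [K^1] inside the interval, zero
   elsewhere. *)
Definition itv_dim (t : R) : nat := `[< itv_carrier I t >].

Let map s t (hst : leR s t) : {linear 'rV[K]_(itv_dim s) -> 'rV[K]_(itv_dim t)}
  := mulmxr (const_mx 1 : 'M[K]_(itv_dim s, itv_dim t)).

Let map_id t (htt : leR t t) : map htt =1 id.
Proof.
move=> x; apply/rowP => i; rewrite /= mxE.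
move: x i; rewrite /itv_dim; case: asboolP => _ x i; last by case: i.
by rewrite big_ord1 mxE mulr1 !ord1.
Qed.

Let map_comp s t u (hst : leR s t) (htu : leR t u) (hsu : leR s u) :
  map htu \o map hst =1 map hsu.
Proof.
move=> x /=; rewrite -mulmxA; congr (_ *m _).
have : itv_carrier I s -> itv_carrier I u -> itv_carrier I t.
  by move=> Is Iu; apply: (itv_convex Is Iu); apply/andP.
rewrite /itv_dim.
case: (asboolP (itv_carrier I s)) => [Is|_] h; last by apply/matrixP => -[].
case: (asboolP (itv_carrier I u)) h => [Iu|_] h; last by apply/matrixP => ? -[].
have It := h Is Iu; rewrite (asboolT It).
by apply/matrixP => i j; rewrite !mxE big_ord1 !mxE mulr1.
Qed.

Definition interval_module : opm K R := Persmod map_id map_comp.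

End IntervalModule.

Record interval_decomposition (K : fieldType) (R : realType) (M : opm K R) :=
  IntervalDecomposition {
    dec_index : Type;
    dec_itv : dec_index -> intervalset R;
    dec_iso : persmod_iso M (pm_dsum (fun j => interval_module K (dec_itv j))) }.

(* A multiset of points is a family; a bijection of multisets is a bijection
   between the index types. *)
Record diagram (R : realType) := Diagram {
  dg_index : Type;
  dg_point : dg_index -> \bar R * \bar R }.

(* The points of the diagonal are indexed by [R * nat]: countably many copies
   of each [(x, x)]. *)
Definition Dg (K : fieldType) (R : realType) (M : opm K R)
    (D : interval_decomposition M) : diagram R :=
  @Diagram R (dec_index D + R * nat)%type
    (fun p => match p with
     | inl j => (ereal_inf (EFin @` dec_itv j), ereal_sup (EFin @` dec_itv j))
     | inr (x, _) => (x%:E, x%:E)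
     end).

(* Equal infinite coordinates are at distance 0, whereas
   [`|+oo - +oo| = +oo] in the library. *)
Definition coord_dist (R : realType) (x y : \bar R) : \bar R :=
  (if x == y then 0 else `|x - y|)%E.

Definition point_dist (R : realType) (p q : \bar R * \bar R) : \bar R :=
  maxe (coord_dist p.1 q.1) (coord_dist p.2 q.2).

Definition dB (R : realType) (D D' : diagram R) : \bar R :=
  ereal_inf [set ereal_sup
      (range (fun x => point_dist (dg_point x) (dg_point (mu x))))
    | mu in [set mu : dg_index D -> dg_index D' | bijective mu]].

(* The last branch is [d <= r1] whenever [b <= d]. *)
Definition Pi_restr (R : realType) (r1 r2 : R) (p : \bar R * \bar R) :
    \bar R * \bar R :=
  let: (b, d) := p in
  (if [&& r1%:E <= b, b <= d & d <= r2%:E] then (b, d)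
   else if [&& r1%:E <= b, b <= r2%:E & r2%:E <= d] then (b, r2%:E)
   else if [&& b <= r1%:E, r1%:E <= d & d <= r2%:E] then (r1%:E, d)
   else if [&& b <= r1%:E, r1%:E <= r2%:E & r2%:E <= d] then (r1%:E, r2%:E)
   else if r2%:E <= b then (b, b)
   else (d, d))%E.

Definition diagram_restr (R : realType) (r1 r2 : R) (D : diagram R) :
    diagram R :=
  @Diagram R (dg_index D) (fun x => Pi_restr r1 r2 (dg_point x)).

Definition min_coord (R : realType) (d : nat) (m : 'rV[R]_d.+1) : R :=
  \big[Num.min/m 0 ord0]_(i < d.+1) m 0 i.

(* A parametrized line: suprema over all [line]s run over all parametrizations
   of each geometric line, on which [min_coord * dB] takes a common value. *)
Record line (R : realType) (d : nat) := Line {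
  dir : 'rV[R]_d.+1;
  base : 'rV[R]_d.+1;
  dir_gt0 : 0 < min_coord dir }.

Definition line_pt (R : realType) (d : nat) (L : line R d) (s : R) :
  'rV[R]_d.+1 := s *: dir L + base L.

Lemma line_pt_mono (R : realType) (d : nat) (L : line R d) (s t : R) :
  leR s t -> preceq (line_pt L s) (line_pt L t).
Proof.
move=> st i; rewrite !mxE lerD2r ler_wpM2r// ltW//.
by apply: (lt_le_trans (dir_gt0 L)); rewrite /min_coord (bigD1 i) //= ge_min lexx.
Qed.

Definition line_restr (K : fieldType) (R : realType) (d : nat) (X : mpm K R d)
    (L : line R d) : opm K R :=
  pm_pullback (@line_pt_mono R d L) X.

(* The multiset of intervals does not depend on the decomposition
   (Krull-Remak-Schmidt-Azumaya), so diagrams are read off any given one. *)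
Definition line_decomposition (K : fieldType) (R : realType) (d : nat)
    (X : mpm K R d) : Type :=
  forall L : line R d, interval_decomposition (line_restr X L).

Section MatchingDistance.
Variables (K : fieldType) (R : realType) (d : nat) (X Y : mpm K R d).
Variables (DX : line_decomposition X) (DY : line_decomposition Y).
Local Open Scope ereal_scope.

Definition dmatch : \bar R :=
  ereal_sup (range (fun L : line R d =>
    (min_coord (dir L))%:E * dB (Dg (DX L)) (Dg (DY L)))).

Definition line_params (B : set 'rV[R]_d.+1) (L : line R d) : set R :=
  [set s | B (line_pt L s)].

(* For a box [B] met by [L], the set [line_params B L] is the closed bounded
   interval between its infimum and its supremum. *)
Definition dmatch_restr (B : set 'rV[R]_d.+1) : \bar R :=
  ereal_sup (range (fun L : line R d =>
    let I := line_params B L in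
    if `[< I !=set0 >] then
      (min_coord (dir L))%:E *
        dB (diagram_restr (inf I) (sup I) (Dg (DX L)))
           (diagram_restr (inf I) (sup I) (Dg (DY L)))
    else 0)).

End MatchingDistance.

Definition box (R : realType) (d : nat) (r1 r2 : 'rV[R]_d.+1) :
    set 'rV[R]_d.+1 :=
  [set u | forall i, u 0 i \in `[r1 0 i, r2 0 i]].

(* Main.v *)
Require Import Defs.
From HB Require Import structures.
From mathcomp Require Import all_boot all_order all_algebra.
From mathcomp Require Import all_classical all_reals all_analysis.

(** Restricting a diagram to an interval does not increase bottleneck
    distances, because [Pi_restr] is 1-Lipschitz for [point_dist] on the
    half-plane of points (b, d) with b <= d.  The six-case definition hides
    this, but on that half-plane it collapses to the single lattice expression
      (max (b, min (r1, d)), min (d, max (r2, b)))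
    ([Pi_restr_minmax]).  Moreover two extended coordinates are at distance at
    most a real e exactly when each is bounded by the other plus e
    ([coord_dist_leP]); min and max are monotone and commute with adding e, so
    bounds of this kind pass through the lattice expression
    ([Pi_restr_lipschitz]).

    A bijection between two diagrams is also a bijection between their
    restrictions, and by the Lipschitz bound it does not cost more there; hence
    [dB_restr_le].  The theorem follows line by line, since the weight
    [min_coord] is positive.  It remains that the parameters of a line inside a
    box form a bounded set, so that inf <= sup, and that lines missing the box
    contribute 0, which is harmless because bottleneck distances between
    diagrams of modules are nonnegative. *)

Set Implicit Arguments.
Unset Strict Implicit.
Unset Printing Implicit Defensive.

Import Order.TTheory GRing.Theory Num.Theory.

Local Open Scope classical_set_scope.
Local Open Scope ring_scope.

Section RestrictionMap.
Variable R : realType.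
Implicit Types (b d x y : \bar R) (p q : \bar R * \bar R) (e r : R).
Local Open Scope ereal_scope.

Lemma coord_dist_ge0 x y : 0 <= coord_dist x y.
Proof. by rewrite /coord_dist; case: ifP. Qed.

Lemma point_dist_ge0 p q : 0 <= point_dist p q.
Proof. by rewrite /point_dist le_max coord_dist_ge0. Qed.

(** Unlike the distance itself, the right-hand side needs no case analysis on
    infinite coordinates and is visibly compatible with min and max. *)
Lemma coord_dist_leP x y e : (0 <= e)%R ->
  coord_dist x y <= e%:E <-> x <= y + e%:E /\ y <= x + e%:E.
Proof.
move=> e0; rewrite /coord_dist; case: eqVneq => [->|].
  by rewrite lee_fin e0 leeDl ?lee_fin.
move: x y => [x| |] [y| |] //= neq; rewrite ?lee_fin ?leey ?leNye //=;
  try by split => // -[].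
rewrite ler_distlC lerBlDr.
by split => [/andP[? ?]|[-> ->]].
Qed.

Lemma Pi_restr_minmax r1 r2 b d : (r1 <= r2)%R -> b <= d ->
  Pi_restr r1 r2 (b, d)
    = (maxe b (mine r1%:E d), mine d (maxe r2%:E b)).
Proof.
rewrite -lee_fin /Pi_restr => r12 bd; rewrite r12 bd /=.
have [r1b|br1] := leP r1%:E b.
  have r1d := le_trans r1b bd; rewrite (min_l r1d) (max_l r1b) r1d /=.
  have [dr2|r2d] := leP d r2%:E.
    by rewrite (max_l (le_trans bd dr2)) (min_l dr2).
  have [br2|r2b] /= := leP b r2%:E.
    by rewrite (ltW r2d) (min_r (ltW r2d)).
  by rewrite (ltW r2b) (min_r bd) leNgt (le_lt_trans r12 r2b).
have br2 := le_trans (ltW br1) r12.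
rewrite (ltW br1) /= (max_l br2) (leNgt _ b) (lt_le_trans br1 r12) /=.
have [r1d|dr1] /= := leP r1%:E d.
  rewrite (max_r (ltW br1)).
  by have [dr2|r2d] := leP d r2%:E => //=; rewrite (ltW r2d).
rewrite (max_r bd) leNgt (lt_le_trans dr1 r12) /=.
by rewrite (min_l (ltW (lt_le_trans dr1 r12))).
Qed.

Lemma maxe_le_addr x y x' y' e : x <= x' + e%:E -> y <= y' + e%:E ->
  maxe x y <= maxe x' y' + e%:E.
Proof.
move=> hx hy; rewrite ge_max (le_trans hx) ?(le_trans hy) //;
  by rewrite leeD2r // le_max lexx ?orbT.
Qed.

Lemma mine_le_addr x y x' y' e : x <= x' + e%:E -> y <= y' + e%:E ->
  mine x y <= mine x' y' + e%:E.
Proof.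
by move=> hx hy; have [_|_] := leP x' y'; rewrite ge_min ?hx ?hy ?orbT.
Qed.

Lemma Pi_restr_lipschitz r1 r2 p q : (r1 <= r2)%R ->
  p.1 <= p.2 -> q.1 <= q.2 ->
  point_dist (Pi_restr r1 r2 p) (Pi_restr r1 r2 q) <= point_dist p q.
Proof.
case: p q => [b d] [b' d'] r12 bd bd'; rewrite !Pi_restr_minmax //.
have := point_dist_ge0 (b, d) (b', d').
case E : (point_dist (b, d) (b', d')) => [e| |] // e0; last by rewrite leey.
rewrite lee_fin in e0.
have /= : point_dist (b, d) (b', d') <= e%:E by rewrite E.
rewrite /point_dist /= !ge_max => /andP[].
move=> /(coord_dist_leP _ _ e0)[b1 b2] /(coord_dist_leP _ _ e0)[d1 d2].
have cst r : r%:E <= r%:E + e%:E by rewrite leeDl ?lee_fin.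
by apply/andP; split; apply/coord_dist_leP => //; split;
  do ?[apply: maxe_le_addr | apply: mine_le_addr | exact: cst].
Qed.

End RestrictionMap.

Section Bottleneck.
Variable R : realType.
Implicit Types D : diagram R.
Local Open Scope ereal_scope.

(** Inhabitation matters: between empty diagrams the supremum is over the empty
    set, hence -oo. *)
Lemma dB_ge0 D D' : dg_index D -> 0 <= dB D D'.
Proof.
move=> i; apply: le_ereal_inf_tmp => _ [mu _ <-].
apply: (le_trans (point_dist_ge0 (dg_point i) (dg_point (mu i)))).
by apply: ereal_sup_ubound; exists i.
Qed.

Lemma dB_restr_le (r1 r2 : R) D D' : (r1 <= r2)%R ->
  (forall i : dg_index D, (dg_point i).1 <= (dg_point i).2) ->
  (forall i : dg_index D', (dg_point i).1 <= (dg_point i).2) ->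
  dB (diagram_restr r1 r2 D) (diagram_restr r1 r2 D') <= dB D D'.
Proof.
move=> r12 hD hD'; apply: le_ereal_inf_tmp => _ [mu bij_mu <-].
apply: ge_ereal_inf; eexists; first by exists mu.
apply: ge_ereal_sup => _ [i _ <-] /=.
apply: (le_trans (Pi_restr_lipschitz r12 (hD i) (hD' (mu i)))).
by apply: ereal_sup_ubound; exists i.
Qed.

Lemma Dg_birth_le_death (K : fieldType) (M : persmod K (@leR R))
    (D : interval_decomposition M) (i : dg_index (Dg D)) :
  (dg_point i).1 <= (dg_point i).2.
Proof.
case: i => [j|[x n]] //=; have [t It] := itv_nonempty (dec_itv j).
apply: (@le_trans _ _ t%:E).
  by apply: ereal_inf_lbound; exists t.
by apply: ereal_sup_ubound; exists t.
Qed.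

End Bottleneck.

Section Lines.
Variables (R : realType) (d : nat).

Lemma min_coord_le (m : 'rV[R]_d.+1) i : min_coord m <= m 0 i.
Proof. by rewrite /min_coord (bigD1 i) //= ge_min lexx. Qed.

(** One coordinate suffices: as its speed is positive, the parameters lie
    between the times at which it enters and leaves its interval. *)
Lemma line_params_box_bounded (r1 r2 : 'rV[R]_d.+1) (L : line R d) :
  has_lbound (line_params (box r1 r2) L) /\
  has_ubound (line_params (box r1 r2) L).
Proof.
have m0 : 0 < dir L 0 ord0 := lt_le_trans (dir_gt0 L) (min_coord_le _ _).
split; [exists ((r1 0 ord0 - base L 0 ord0) / dir L 0 ord0)
       |exists ((r2 0 ord0 - base L 0 ord0) / dir L 0 ord0)];
  move=> s /(_ ord0); rewrite in_itv /= !mxE => /andP[h1 h2].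
- by rewrite ler_pdivrMr // lerBlDr.
- by rewrite ler_pdivlMr // lerBrDr.
Qed.

End Lines.

Theorem corollary7 (R : realType) (K : fieldType) (d : nat)
    (X Y : persmod K (@preceq R d.+1))
    (DX : line_decomposition X) (DY : line_decomposition Y)
    (r1 r2 : 'rV[R]_d.+1) :
  (dmatch_restr DX DY (box r1 r2) <= dmatch DX DY)%E.
Proof.
apply: ge_ereal_sup => _ [L _ <-] /=.
have m0 : (0 <= (min_coord (dir L))%:E)%E by rewrite lee_fin ltW // dir_gt0.
apply: (@le_trans _ _
  ((min_coord (dir L))%:E * dB (Dg (DX L)) (Dg (DY L)))%E); last first.
  by apply: ereal_sup_ubound; exists L.
case: asboolP => [[s Is]|_]; last first.
  (* A diagonal point witnesses that the diagram is inhabited. *)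
  by apply: mule_ge0 => //; apply: dB_ge0; exact: (inr (0, 0%N)).
apply: lee_wpmul2l => //; apply: dB_restr_le; try exact: Dg_birth_le_death.
have [lb ub] := line_params_box_bounded r1 r2 L.
by apply: (@le_trans _ _ s); [exact: ge_inf | exact: ub_le_sup].
Qed.
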